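(* Let $K$ be an algebraically closed field of characteristic $0$ and let $d,n$ be integers with $1<d<n$ and $\gcd(n,d)=1$. Let $f(x)\in K[x]$ be a monic polynomial of degree $n$ without repeated roots, $\mathcal{C}_{f,d}$ the smooth projective model of $y^d=f(x)$, $m_1:=n+d$, and $a\in K$. The following are equivalent: (a) there exists $P\in\mathcal{C}_{f,d}(K)$ of order $m_1$ with $x(P)=a$; (b) there exist $a_1\in K$ and $v(x)\in K[x]$ such that $a_1\neq a$, $d-1\leq \deg(v)<m_1/d=(n+d)/d$, $v(a_1)\neq 0$, and $f(x)=\dfrac{(x-a)^{m_1}-v(x)^d}{(x-a_1)^d}$. If these equivalent conditions hold, then $m_1=n+d>d^2-d$.
   Context: $\mathcal{C}_{f,d}$ has a unique point at infinity $O$, and $\mathcal{C}_{f,d}\setminus\{O\}$ is identified with the affine curve $y^d=f(x)$, so $x(P)$ denotes the abscissa of $P\neq O$. $\mathcal{C}_{f,d}$ is identified with its image in its Jacobian via $P\mapsto \operatorname{cl}((P)-(O))$ (linear equivalence class); $P$ has order $m$ if $\operatorname{cl}((P)-(O))$ has order $m$ in $J(\mathcal{C}_{f,d})(K)$. *)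

(* Defs.v *)
From HB Require Import structures.
From mathcomp Require Import all_boot all_order all_algebra.
Set Implicit Arguments. Unset Strict Implicit. Unset Printing Implicit Defensive.
Import Order.TTheory GRing.Theory Num.Theory.
Local Open Scope ring_scope.

(* Superelliptic curve C_{f,d} : y^d = f(x).  Elements of the affine
   coordinate ring A = K[x,y]/(y^d - f(x)) are represented by elements of
   {poly {poly K}} (outer variable = y, coefficients in K[x]), taken modulo
   the curve polynomial y^d - f(x). *)
Section Superelliptic.
Variable K : fieldType.

Definition curve_poly (f : {poly K}) (d : nat) : {poly {poly K}} :=
  'X^d - f%:P.

Definition on_curve (f : {poly K}) (d : nat) (a b : K) : Prop :=
  b ^+ d = f.[a].

Definition curve_cong (f : {poly K}) (d : nat) (p q : {poly {poly K}}) : Prop :=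
  exists t : {poly {poly K}}, p - q = t * curve_poly f d.

Definition ev2 (h : {poly {poly K}}) (a b : K) : K := (h.[b%:P]).[a].

Definition xm (a : K) : {poly {poly K}} := ('X - a%:P)%:P.
Definition ym (b : K) : {poly {poly K}} := 'X - (b%:P)%:P.

(* ord_{(a,b)}(h) >= k : h lies in m_P^k A_P, i.e. s*h is in m_P^k for some
   s in A with s(P) <> 0, where m_P = (x - a, y - b). *)
Definition ord_ge (f : {poly K}) (d : nat) (a b : K) (h : {poly {poly K}})
  (k : nat) : Prop :=
  exists s : {poly {poly K}}, ev2 s a b != 0 /\
  exists c : nat -> {poly {poly K}},
    curve_cong f d (s * h)
      (\sum_(i < k.+1) c i * xm a ^+ i * ym b ^+ (k - i)).

Definition ord_eq (f : {poly K}) (d : nat) (a b : K) (h : {poly {poly K}})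
  (k : nat) : Prop :=
  ord_ge f d a b h k /\ ~ ord_ge f d a b h k.+1.

(* k(P) - k(O) is a principal divisor, P = (a,b): there is a function h,
   regular on the affine curve (i.e. h in A), whose only affine zero is P,
   with order exactly k there (its divisor is then k(P) - k(O)). *)
Definition principal_kP (f : {poly K}) (d : nat) (a b : K) (k : nat) : Prop :=
  exists h : {poly {poly K}},
    ord_eq f d a b h k /\
    forall a' b' : K, on_curve f d a' b' -> (a', b') != (a, b) ->
      ord_eq f d a' b' h 0.

(* the point P = (a,b) has order m in the Jacobian, i.e. cl((P)-(O)) has
   order m *)
Definition point_order (f : {poly K}) (d : nat) (a b : K) (m : nat) : Prop :=
  (0 < m)%N /\ principal_kP f d a b m /\
  forall k : nat, (0 < k)%N -> (k < m)%N -> ~ principal_kP f d a b k.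

End Superelliptic.

(* Main.v *)
(* A function h = sum_j h_j(x) y^j with j < d has pole order
   max_j (d deg h_j + n j) at O, the maximum being attained once since
   gcd(n, d) = 1.  The norm of h to K[x], i.e. the product of its conjugates
   h(x, z^i y) for z a primitive d-th root of unity, has that degree; if P is
   the only affine zero of h and y(P) <> 0, the norm is a constant times a power
   of x - a whose exponent is ord_P(h).  So ord_P(h) is the pole order.
   Locally, when y(P) <> 0, x - a is a uniformizer: ord_P(h) is read off
   h(x, Y(x)), for Y a polynomial approximation of the branch of f^(1/d) through P.

   If P has order n + d (then y(P) <> 0, as otherwise x - a shows that its order
   is at most d), the weights force h = c ((x - a1) y - u(x)), and comparing
   norms gives (x - a1)^d f - u^d = (x - a)^(n + d); (b) follows with v = w u,
   w^d = -1.  Here deg v >= d - 1 because (x - a1)^(d-1) divides the nonzero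
   polynomial (n + d) v - d (x - a) v', whose degree is at most deg v.

   Conversely (x - a1) y - w v has divisor (n + d)(P) - (n + d)(O).  A principal
   k(P) - k(O) with 0 < k < n + d would come from c y + u, with c <> 0 and
   k >= n; then (x - a)^k divides the nonzero polynomial (x - a1) u + c w v,
   whose degree is too small. *)
Require Import Defs.
From HB Require Import structures.
From mathcomp Require Import all_boot all_order all_algebra all_solvable all_field.
From mathcomp Require Import ring zify.
Import Order.TTheory GRing.Theory Num.Theory.
Local Open Scope ring_scope.

(** * Orders of vanishing *)

Section Local.
Variables (K : fieldType) (f : {poly K}) (d : nat).
Implicit Types (a b : K) (h : {poly {poly K}}).

Lemma ev2E h (Y : {poly K}) a : (h.[Y]).[a] = ev2 h a Y.[a].
Proof.
have E Z : (h.[Z]).[a] = (map_poly (horner_eval a) h).[Z.[a]].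
  by rewrite -[in RHS]/(horner_eval a Z) horner_map.
by rewrite /ev2 !E hornerC.
Qed.

(** A morphism [e] compatible with evaluation at P sends m_P into the multiples of X - t, and s to a
    polynomial not vanishing at t. It respects the curve only modulo (X - t)^N, hence [k <= N]. It
    serves for y = Y(x) and, at ramified points, for x expressed in y. *)
Lemma ord_ge_dvd a b (e : {rmorphism {poly {poly K}} -> {poly K}}) (t : K)
    N k h :
  (forall s, (e s).[t] = ev2 s a b) -> ('X - t%:P) ^+ N %| e (curve_poly f d) ->
  (k <= N)%N -> ord_ge f d a b h k -> ('X - t%:P) ^+ k %| e h.
Proof.
move=> eE eC kN [s [s0 [c [u su]]]].
have: e (s * h) = e (\sum_(i < k.+1) c i * xm a ^+ i * ym b ^+ (k - i))
    + e u * e (curve_poly f d).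
  by rewrite -rmorphM -su -rmorphD /= addrC subrK.
rewrite rmorphM /= => E.
suff: ('X - t%:P) ^+ k %| e s * e h.
  rewrite Gauss_dvdpr //; apply: coprimep_expl.
  by rewrite coprimep_sym coprimep_XsubC rootE eE.
have ex : 'X - t%:P %| e (xm a).
  by rewrite dvdp_XsubCl rootE eE /ev2 /xm !hornerE subrr.
have ey : 'X - t%:P %| e (ym b).
  by rewrite dvdp_XsubCl rootE eE /ev2 /ym !hornerE subrr.
rewrite E dvdp_add //; last first.
  by rewrite dvdp_mull // (dvdp_trans _ eC) // dvdp_exp2l.
rewrite rmorph_sum; elim/big_ind: _ => [|x y|i _]; [exact: dvdp0|exact: dvdp_add|].
have -> : ('X - t%:P) ^+ k = ('X - t%:P) ^+ i * ('X - t%:P) ^+ (k - i).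
  by rewrite -exprD subnKC // -ltnS.
rewrite !rmorphM /= !rmorphXn /= -mulrA dvdp_mull //.
by rewrite dvdp_mul // dvdp_exp2r.
Qed.

Lemma ev2_eq0_ideal a h b : (h.[b%:P]).[a] = 0 ->
  exists q r, h = q * ym b + r%:P * xm a.
Proof.
move=> hab.
have /factor_theorem [q Eq] : root (h - (h.[b%:P])%:P) b%:P.
  by rewrite rootE !hornerE subrr.
have /factor_theorem [r Er] : root h.[b%:P] a by rewrite rootE hab.
exists q, r; rewrite /ym /xm -Eq -rmorphM /= -Er.
by rewrite subrK.
Qed.

Lemma ord_ge1 a b h : on_curve f d a b -> ord_ge f d a b h 1 <-> ev2 h a b = 0.
Proof.
move=> ab; split.
  move=> H; apply/eqP; rewrite -rootE -dvdp_XsubCl.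
  (* The constant b parametrises the curve to first order, even when b = 0. *)
  apply: (@ord_ge_dvd a b (horner_eval b%:P) a 1 1 h) => //.
  rewrite expr1 dvdp_XsubCl rootE /= /horner_eval /curve_poly !hornerE.
  by rewrite ab subrr.
move=> /ev2_eq0_ideal [q [r Eh]].
exists 1; split; first by rewrite /ev2 !hornerE oner_eq0.
exists (fun i => if i == 0%N then q else r%:P), 0.
by rewrite !big_ord_recr big_ord0 /= !expr0 !expr1 !mulr1 mul1r add0r Eh subrr mul0r.
Qed.

Lemma ord_ge0 a b h : ord_ge f d a b h 0.
Proof.
exists 1; split; first by rewrite /ev2 !hornerE oner_eq0.
by exists (fun=> h), 0; rewrite big_ord1 !expr0 !mulr1 mul1r subrr mul0r.
Qed.

Lemma ord_eq0P a b h : on_curve f d a b ->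
  ord_eq f d a b h 0 <-> ev2 h a b != 0.
Proof.
move=> ab; split=> [[_ H]|/eqP H]; first by apply/eqP => /(ord_ge1 _ _ _ ab).
by split; [exact: ord_ge0 | move/(ord_ge1 _ _ _ ab)].
Qed.

Lemma ord_ge_cong a b h g k : curve_cong f d h g ->
  ord_ge f d a b h k -> ord_ge f d a b g k.
Proof.
move=> [t E] [s [s0 [c [u su]]]]; exists s; split=> //; exists c, (u - s * t).
rewrite mulrBl -su -mulrA -E; ring.
Qed.

Lemma curve_cong_sym h g : curve_cong f d h g -> curve_cong f d g h.
Proof. by move=> [t E]; exists (- t); rewrite mulNr -E opprB. Qed.

(** Division by the monic curve polynomial leaves a remainder congruent to h, so all orders are
    kept. *)
Lemma principal_kP_reduced a b k : principal_kP f d a b k ->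
  (0 < d)%N ->
  exists h, (size h <= d)%N /\ ord_eq f d a b h k /\
    forall a' b', on_curve f d a' b' -> (a', b') != (a, b) -> ev2 h a' b' != 0.
Proof.
move=> [h [[h1 h2] H]] d0.
have Cm : curve_poly f d \is monic by rewrite /curve_poly monicXnsubC.
have cong : curve_cong f d h (Pdiv.Ring.rmodp h (curve_poly f d)).
  by eexists; rewrite {1}(Pdiv.RingMonic.rdivp_eq Cm h) addrK.
exists (Pdiv.Ring.rmodp h (curve_poly f d)); split.
  rewrite -ltnS; have := Pdiv.Ring.ltn_rmodp h (curve_poly f d).
  by rewrite monic_neq0 // /curve_poly size_XnsubC.
split.
  split; first exact: ord_ge_cong h1.
  by move=> /(ord_ge_cong _ _ _ _ _ (curve_cong_sym _ _ cong)).
move=> a' b' ab' /(H _ _ ab') [_ H'].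
apply/eqP => /(ord_ge1 _ _ _ ab').
by move=> /(ord_ge_cong _ _ _ _ _ (curve_cong_sym _ _ cong)).
Qed.

(** * Branches y = Y(x) at points with y nonzero *)

Section Unramified.
Variables (a b : K).
Hypotheses (dK : d%:R != 0 :> K) (b0 : b != 0) (ab : on_curve f d a b).

Lemma geom_at (p q : {poly K}) c : p.[a] = c -> q.[a] = c ->
  (\sum_(i < d) p ^+ (d.-1 - i) * q ^+ i).[a] = d%:R * c ^+ d.-1.
Proof.
move=> pa qa; rewrite horner_sum (eq_bigr (fun=> c ^+ d.-1)).
  by rewrite sumr_const card_ord mulr_natl.
move=> i _; rewrite !hornerE pa qa -exprD subnK //.
by rewrite -ltnS (leq_trans (ltn_ord i)) // leqSpred.
Qed.

Lemma hensel N : exists Y : {poly K},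
  Y.[a] = b /\ ('X - a%:P) ^+ N %| Y ^+ d - f.
Proof.
elim: N => [|[|N] [Y [Ya]]]; first by exists b%:P; rewrite hornerC dvd1p.
  by exists b%:P; rewrite hornerC expr1 dvdp_XsubCl rootE !hornerE ab subrr.
case/dvdpP=> e E.
(* Newton correction: the new cofactor has value t d b^(d-1) + e(a) = 0 at a. *)
pose t := - e.[a] / (d%:R * b ^+ d.-1).
pose Z := Y + t%:P * ('X - a%:P) ^+ N.+1.
have Za : Z.[a] = b by rewrite /Z !hornerE subrr expr0n mulr0 addr0.
exists Z; split=> //.
have -> : Z ^+ d - f = (t%:P * (\sum_(i < d) Z ^+ (d.-1 - i) * Y ^+ i) + e)
    * ('X - a%:P) ^+ N.+1.
  rewrite mulrDl -E -(subrK (Y ^+ d) (Z ^+ d)) subrXX -addrA; congr (_ + _).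
  by rewrite {1}/Z; ring.
rewrite [('X - a%:P) ^+ N.+2]exprS dvdp_mul // dvdp_XsubCl rootE.
rewrite hornerD hornerM hornerC (geom_at _ _ _ Za Ya) /t divfK ?addNr //.
by rewrite mulf_neq0 // expf_neq0.
Qed.

Lemma ord_ge_of_dvd (Y : {poly K}) k h : Y.[a] = b ->
  ('X - a%:P) ^+ k %| Y ^+ d - f -> ('X - a%:P) ^+ k %| h.[Y] ->
  ord_ge f d a b h k.
Proof.
move=> Ya /dvdpP [e E] /dvdpP [r Er].
(* s = (y^d - Y^d) / (y - Y) has value d b^(d-1) at P, and s (y - Y) is congruent to f - Y^d, a
   multiple of (x - a)^k. *)
pose s : {poly {poly K}} := \sum_(i < d) 'X ^+ (d.-1 - i) * Y%:P ^+ i.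
have /factor_theorem [q Eq] : root (h - (h.[Y])%:P) Y.
  by rewrite rootE !hornerE subrr.
exists s; split.
  have -> : ev2 s a b = d%:R * b ^+ d.-1.
    rewrite /ev2 -(@geom_at b%:P Y) ?hornerC //; congr (_.[a]).
    by rewrite horner_sum; apply: eq_bigr => i _; rewrite !hornerE.
  by rewrite mulf_neq0 // expf_neq0.
exists (fun i => if i == k then s * r%:P - q * e%:P else 0), q.
rewrite big_ord_recr big1 /=; last first.
  by move=> i _; rewrite ltn_eqF ?mul0r.
rewrite eqxx subnn expr0 mulr1 add0r /xm -rmorphXn /=.
rewrite mulrBl -!mulrA -!rmorphM /= -E -Er.
have -> : h = (h.[Y])%:P + q * ('X - Y%:P) by rewrite -Eq addrC subrK.
rewrite !hornerE subrr mulr0 addr0 mulrDr.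
have -> : s * (q * ('X - Y%:P)) = q * (('X - Y%:P) * s) by ring.
rewrite /s -subrXX /curve_poly rmorphB /= rmorphXn /=. ring.
Qed.

Lemma ord_geP (Y : {poly K}) N k h : Y.[a] = b ->
  ('X - a%:P) ^+ N %| Y ^+ d - f -> (k <= N)%N ->
  ord_ge f d a b h k <-> ('X - a%:P) ^+ k %| h.[Y].
Proof.
move=> Ya YN kN; split.
  apply: (@ord_ge_dvd a b (horner_eval Y) a N k h) => //.
    by move=> s; rewrite /horner_eval ev2E Ya.
  by rewrite /= /horner_eval /curve_poly !hornerE.
by apply: ord_ge_of_dvd => //; apply: dvdp_trans YN; apply: dvdp_exp2l.
Qed.
End Unramified.
End Local.

(** * Norms and weights *)

Lemma coprime_mul_inj n d i q : coprime n d -> (i < d)%N -> (q < d)%N ->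
  n * i = n * q %[mod d] -> i = q.
Proof.
move=> cop; wlog iq : i q / (i <= q)%N => [H id qd E|id qd /eqP].
  by case/orP: (leq_total i q) => h; [|symmetry]; apply: H.
rewrite eq_sym eqn_mod_dvd ?leq_mul2l ?iq ?orbT // -mulnBr Gauss_dvdr 1?coprime_sym //.
have [E|E] := posnP (q - i); first by lia.
by move/(dvdn_leq E); lia.
Qed.

Section Norm.
Variables (K : fieldType) (f : {poly K}) (d n : nat).
Hypotheses (fsize : size f = n.+1) (d0 : (0 < d)%N).
Implicit Types (h g G : {poly {poly K}}).

Definition twist (c : K) h := h \Po (c%:P%:P * 'X).

Lemma horner_twist c h Y : (twist c h).[Y] = h.[c%:P * Y].
Proof. by rewrite /twist horner_comp !hornerE. Qed.

Lemma twist_twist c e h : twist c (twist e h) = twist (c * e) h.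
Proof.
rewrite /twist -comp_polyA comp_polyM comp_polyC comp_polyX mulrA.
by rewrite -!polyCM (mulrC e).
Qed.

Lemma coef_twist c h i : (twist c h)`_i = h`_i * (c ^+ i)%:P.
Proof.
rewrite /twist comp_polyE coef_sum.
have E j : (h`_j *: (c%:P%:P * 'X) ^+ j)`_i = if j == i then h`_i * (c ^+ i)%:P else 0.
  rewrite exprMn -rmorphXn -rmorphXn coefZ coefCM coefXn eq_sym.
  by case: eqP => [->|_]; rewrite ?mulr1 ?mulr0.
case: (ltnP i (size h)) => hi.
  rewrite (bigD1 (Ordinal hi)) //= E eqxx big1 ?addr0 // => j ji.
  by rewrite E ifN.
rewrite nth_default // mul0r big1 // => j _; rewrite E.
by case: eqP => // _; rewrite nth_default // mul0r.
Qed.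

(** For z a primitive d-th root of unity, this is the norm to K[x] before y^d is replaced by f,
    which [descend] does. *)
Definition norm_poly (z : K) h := \prod_(i < d) twist (z ^+ i) h.

Lemma norm_poly_twist z h : z ^+ d = 1 -> twist z (norm_poly z h) = norm_poly z h.
Proof.
move=> zd; rewrite /norm_poly {1}/twist rmorph_prod /=.
under eq_bigr => i _ do rewrite -/(twist z (twist _ h)) twist_twist -exprS.
move: zd d0; case: (d) => // m zm _.
by rewrite big_ord_recr big_ord_recl /= zm expr0 mulrC.
Qed.

(** By invariance under y -> z y, the coefficient of y^i equals itself times z^i, and z^i is not
    1. *)
Lemma norm_poly_coef z h i : d.-primitive_root z -> ~~ (d %| i)%N ->
  (norm_poly z h)`_i = 0.
Proof.
move=> zd; rewrite (prim_order_dvd zd) => zi.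
have := congr1 (fun g : {poly {poly K}} => g`_i)
  (norm_poly_twist _ h (prim_expr_order zd)).
rewrite /= coef_twist => /eqP; rewrite -subr_eq0 -{2}[_`_i]mulr1 -mulrBr.
rewrite mulf_eq0 subr_eq0 -polyC1.
by rewrite (inj_eq polyC_inj) (negPf zi) orbF => /eqP.
Qed.

(* If the exponents of y in G are multiples of d, this is G with y^d replaced
   by f; other exponents give junk. *)
Definition descend G : {poly K} := \sum_(i < size G) G`_i * f ^+ (i %/ d).

(** Modulo Y^d - f every Y^(dk) becomes f^k. [Y] will be a constant, to locate zeros, or a branch,
    to compute orders at P. *)
Lemma descend_dvd G Y : (forall i, ~~ (d %| i)%N -> G`_i = 0) ->
  Y ^+ d - f %| G.[Y] - descend G.
Proof.
move=> Gi; rewrite horner_coef -sumrB.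
elim/big_ind: _ => [|x y|i _]; [exact: dvdp0|exact: dvdp_add|].
case: (boolP (d %| i)%N) => [/dvdnP[k ->]|/Gi ->]; last by rewrite !mul0r subrr dvdp0.
by rewrite mulnK // mulnC exprM -mulrBr subrXX dvdp_mull // dvdp_mulr.
Qed.

(* x has weight d and y has weight n, their pole orders at the point at
   infinity. *)
Definition weight_lt W h :=
  forall i j, (W <= d * j + n * i)%N -> h`_i`_j = 0.

Definition top_monomial h (c : K) p q :=
  weight_lt (d * p + n * q) (h - (c *: 'X^p)%:P * 'X^q).

(** The bound [B.+1] allows weight B in the second factor: strictness in one factor is enough. *)
Lemma weight_ltM A B h g : weight_lt A h -> weight_lt B.+1 g ->
  weight_lt (A + B) (h * g).
Proof.
move=> hA gB i j AB; rewrite coefM coef_sum big1 // => k _.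
rewrite coefM big1 // => l _.
case: (leqP A (d * l + n * k)) => [/hA->|lk]; first by rewrite mul0r.
rewrite gB ?mulr0 //.
have := ltn_ord k; have := ltn_ord l; rewrite !ltnS => lj ki.
rewrite -(leq_add2l (d * l + n * k)) addnACA -!mulnDr !subnKC //.
by apply: leq_trans AB; rewrite addnS -addSn leq_add2r.
Qed.

Lemma weight_ltD A h g : weight_lt A h -> weight_lt A g -> weight_lt A (h + g).
Proof. by move=> hA gA i j ij; rewrite !coefD hA ?gA ?addr0. Qed.

Lemma weight_ltS A h : weight_lt A h -> weight_lt A.+1 h.
Proof. by move=> hA i j ij; apply: hA; apply: ltnW. Qed.

Lemma coef_monomial2 (c : K) p q i j :
  ((c *: 'X^p)%:P * 'X^q : {poly {poly K}})`_i`_j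
    = if (i == q) && (j == p) then c else 0.
Proof.
rewrite coefCM coefXn; case: eqP => _ /=; last by rewrite mulr0 coef0.
by rewrite mulr1 coefZ coefXn; case: eqP; rewrite ?mulr1 ?mulr0.
Qed.

Lemma weight_monomial c p q :
  weight_lt (d * p + n * q).+1 ((c *: 'X^p)%:P * 'X^q).
Proof.
move=> i j; rewrite coef_monomial2; case: ifP => // /andP[/eqP-> /eqP->].
by rewrite ltnn.
Qed.

Lemma top_monomialM h g c e p q p' q' :
  top_monomial h c p q -> top_monomial g e p' q' ->
  top_monomial (h * g) (c * e) (p + p') (q + q').
Proof.
rewrite /top_monomial => hT gT.
set m := (X in h - X) in hT; set m' := (X in g - X) in gT.
have -> : ((c * e) *: 'X^(p + p'))%:P * 'X^(q + q') = m * m'.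
  by rewrite /m /m' !exprD -!mul_polyC !rmorphM /=; ring.
have -> : h * g - m * m' = (h - m) * g + (g - m') * m by ring.
apply: weight_ltD.
  have -> : (d * (p + p') + n * (q + q') = d * p + n * q + (d * p' + n * q'))%N by ring.
  apply: weight_ltM => //; rewrite -(subrK m' g).
  by apply: weight_ltD; [exact: weight_ltS|exact: weight_monomial].
have -> : (d * (p + p') + n * (q + q') = d * p' + n * q' + (d * p + n * q))%N by ring.
by apply: weight_ltM => //; exact: weight_monomial.
Qed.

Lemma top_monomial_prod (I : Type) (r : seq I) (F : I -> {poly {poly K}}) c p q :
  (forall i, c i != 0) -> (forall i, top_monomial (F i) (c i) p q) ->
  exists2 e, e != 0 & top_monomial (\prod_(i <- r) F i) e (size r * p) (size r * q).
Proof.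
move=> c0 FT; elim: r => [|x r [e e0 IH]].
  exists 1; rewrite ?oner_eq0 // big_nil !mul0n /top_monomial.
  by rewrite !expr0 alg_polyC mulr1 subrr => i j _; rewrite !coef0.
exists (c x * e); first by rewrite mulf_neq0.
by rewrite big_cons /= !mulSn; apply: top_monomialM.
Qed.

Lemma top_monomial_twist e h c p q : top_monomial h c p q ->
  top_monomial (twist e h) (c * e ^+ q) p q.
Proof.
move=> hT i j ij; have := hT _ _ ij; rewrite !coefB !coef_monomial2 coef_twist.
rewrite coefMC; case: (i =P q) => [->|_] /=; last first.
  by rewrite !subr0 => ->; rewrite mul0r.
case: ifP => _; last by rewrite !subr0 => ->; rewrite mul0r.
by move/eqP; rewrite subr_eq0 => /eqP->; rewrite subrr.
Qed.

(** The heaviest among the leading terms of the h_i is unique: equal weights for i, q < d give n i =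
    n q modulo d, hence i = q. *)
Lemma top_monomial_exists h : h != 0 -> (size h <= d)%N -> coprime n d ->
  exists c p q, [/\ c != 0, top_monomial h c p q & h`_q`_p = c /\ (q < d)%N].
Proof.
move=> hn0 hd cop.
have hs : (0 < size h)%N by rewrite lt0n size_poly_eq0.
pose w (i : nat) := let s := size h`_i in (d * s.-1 + n * i)%N.
pose P (i : 'I_(size h)) := h`_i != 0.
have Pl : P (Ordinal (eq_leq (prednK hs))) by move: hn0; rewrite -lead_coef_eq0.
case: (@arg_maxnP _ (Ordinal (eq_leq (prednK hs))) P (fun i => w i) Pl) => q Pq mq.
have qd : (q < d)%N by apply: leq_trans (ltn_ord q) hd.
exists (lead_coef h`_q), (size h`_q).-1, (q : nat); split=> //.
  by rewrite lead_coef_eq0.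
move=> i j; rewrite -/(w q) => wij; rewrite !coefB coef_monomial2.
case: (i =P q :> nat) => [Ei|iq] /=.
  move: wij; rewrite Ei /w leq_add2r leq_pmul2l // leq_eqVlt.
  case: eqP => [<-|_] /=; first by rewrite eqxx subrr.
  move=> jl; rewrite gtn_eqF // subr0 nth_default //.
  by move: jl; case: (size _).
rewrite subr0; apply/eqP/negPn/negP => hij.
have hi : h`_i != 0 by apply: contraNneq hij => ->; rewrite coef0.
have is' : (i < size h)%N.
  by rewrite ltnNge; apply: contra hi => hi; rewrite nth_default.
have jl : (j <= (size (h`_i)%R).-1)%N.
  rewrite -ltnS prednK ?lt0n ?size_poly_eq0 // ltnNge.
  by apply: contra hij => hj; rewrite nth_default.
have := mq (Ordinal is') hi; rewrite /= {1}/w => le1.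
have E : (d * j + n * i = w q)%N.
  apply/eqP; rewrite eqn_leq wij andbT; apply: leq_trans le1.
  by rewrite leq_add2r leq_mul2l jl orbT.
apply: iq; apply: (coprime_mul_inj _ _ _ _ cop _ qd); first exact: leq_trans is' hd.
have := congr1 (modn^~ d) E; rewrite /w /= ![(d * _)%N]mulnC.
by rewrite !modnMDl.
Qed.

Lemma size_sum_leq (I : Type) (r : seq I) (P : pred I) (F : I -> {poly K}) m :
  (forall i, P i -> (size (F i) <= m)%N) ->
  (size (\sum_(i <- r | P i) F i)%R <= m)%N.
Proof.
move=> Fm; elim/big_ind: _ => [|x y xm ym|//]; first by rewrite size_poly0.
by rewrite (leq_trans (size_polyD _ _)) // geq_max xm.
Qed.

(** Replacing y^d by f turns a monomial of weight W into a polynomial of degree W / d, so the top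
    monomial alone decides the degree. *)
Lemma size_descend G c p q : c != 0 -> (forall i, ~~ (d %| i)%N -> G`_i = 0) ->
  top_monomial G c p q -> size (descend G) = (p + n * (q %/ d)).+1.
Proof.
move=> c0 Gi GT.
have Gq : G`_q`_p = c.
  have := GT q p (leqnn _); rewrite !coefB coef_monomial2 !eqxx.
  by move/eqP; rewrite subr_eq0 => /eqP.
have hq : (q < size G)%N.
  rewrite ltnNge; apply: contra c0 => /(nth_default 0) Gq0.
  by rewrite -Gq Gq0 coef0.
have dq : (d %| q)%N.
  by apply: contraNT c0 => /Gi Gq0; rewrite -Gq Gq0 coef0.
have sf k : size (f ^+ k) = (n * k).+1.
  have f0 : f != 0 by rewrite -size_poly_eq0 fsize.
  rewrite -[LHS]prednK ?lt0n ?size_poly_eq0 ?expf_neq0 //.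
  by rewrite size_exp fsize.
have sGq : size G`_q = p.+1.
  apply/eqP; rewrite eqn_leq; apply/andP; split.
    apply/leq_sizeP => j pj.
    have := GT q j; rewrite leq_add2r leq_pmul2l // (ltnW pj) !coefB.
    by rewrite coef_monomial2 (gtn_eqF pj) andbF subr0; apply.
  rewrite ltnNge; apply: contra c0 => /(nth_default 0) Gqp.
  by rewrite -Gq Gqp.
have f0 k : f ^+ k != 0 by rewrite -size_poly_eq0 sf.
have sq : size (G`_q * f ^+ (q %/ d)) = (p + n * (q %/ d)).+1.
  rewrite size_mul // -?size_poly_eq0 ?sGq //.
  by rewrite sf addnS.
rewrite /descend (bigD1 (Ordinal hq)) //= size_polyDl sq //.
rewrite ltnS; apply: size_sum_leq => i iq.
case: (boolP (d %| i)%N) => [di|/Gi->]; last by rewrite mul0r size_poly0.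
have [->|Gi0] := eqVneq G`_i 0; first by rewrite mul0r size_poly0.
rewrite size_mul // sf addnS /=.
set s := size _.
have s0 : (0 < s)%N by rewrite lt0n size_poly_eq0.
rewrite leqNgt; apply/negP => H.
have : G`_i`_s.-1 = 0.
  have := GT i s.-1; rewrite !coefB coef_monomial2 ifN; last first.
    by apply: contra iq => /andP[/eqP iq _]; apply/eqP/val_inj.
  rewrite subr0; apply.
  rewrite -(divnK dq) -(divnK di) ![(_ %/ _ * _)%N]mulnC !(mulnCA n) -!mulnDr.
  by rewrite leq_pmul2l //; move: H s0; set A := (n * _)%N; set B := (n * _)%N; lia.
by apply/eqP; rewrite -[_`_ _]/(lead_coef _) lead_coef_eq0.
Qed.
End Norm.

(** * Roots over an algebraically closed field *)

Lemma prim_root_exists (K : closedFieldType) d : (0 < d)%N -> d%:R != 0 :> K ->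
  exists z : K, d.-primitive_root z.
Proof.
move=> d0 dK; have [r Er] := closed_field_poly_normal ('X^d - 1 : {poly K}).
have lc : lead_coef ('X^d - 1 : {poly K}) = 1.
  by apply/monicP; rewrite -polyC1 monicXnsubC.
rewrite lc scale1r in Er.
have ur : uniq r by rewrite -separable_prod_XsubC -Er cyclotomic.separable_Xn_sub_1.
have sr : size r = d.
  by apply: succn_inj; rewrite -(size_prod_XsubC r id) -Er -polyC1 size_XnsubC.
have /hasP[z _ zP] : has d.-primitive_root r.
  apply: has_prim_root => //; last by rewrite sr.
  apply/allP => z zr; apply/unity_rootP/eqP; rewrite -subr_eq0.
  have : root ('X^d - 1) z by rewrite Er root_prod_XsubC.
  by rewrite rootE !hornerE.
by exists z.
Qed.

Lemma exists_root_exp (K : closedFieldType) d (c : K) : (0 < d)%N ->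
  exists y, y ^+ d = c.
Proof.
move=> d0; have /closed_rootP[y] : size ('X^d - c%:P) != 1.
  by rewrite size_XnsubC // eqSS -lt0n.
by rewrite rootE !hornerE subr_eq0 => /eqP; exists y.
Qed.

(** Once the full power of x - a is divided out, the quotient has no root, so it is constant. *)
Lemma only_root (K : closedFieldType) (p : {poly K}) (a : K) :
  p != 0 -> (forall c, root p c -> c = a) ->
  exists2 c, c != 0 & p = c *: ('X - a%:P) ^+ (size p).-1.
Proof.
move=> p0 pa; have [m [q /implyP/(_ p0) qa E]] := multiplicity_XsubC p a.
have q0 : q != 0 by apply: contraNneq p0 => q0; rewrite E q0 mul0r.
have : size q == 1.
  apply/negP => /negP/closed_rootP[c qc].
  move: (qc) qa; rewrite (pa c) => [->//|].
  by rewrite E rootM qc.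
case/size_poly1P => c c0 Eq; exists c => //.
by rewrite {2}E size_Mmonic ?monic_exp ?monicXsubC // size_exp_XsubC Eq
  size_polyC c0 /= E Eq mul_polyC.
Qed.

(** * Zero order at P against pole order at O *)

Section Principal.
Variables (K : closedFieldType) (f : {poly K}) (d n : nat) (a b : K).
Hypotheses (fsize : size f = n.+1) (d0 : (0 < d)%N) (cop : coprime n d).
Hypotheses (dK : d%:R != 0 :> K) (b0 : b != 0) (ab : on_curve f d a b).

Lemma zero_order_eq_weight (h : {poly {poly K}}) k :
  (size h <= d)%N -> ord_eq f d a b h k ->
  (forall a' b', on_curve f d a' b' -> (a', b') != (a, b) -> ev2 h a' b' != 0) ->
  exists p q, [/\ (q < d)%N, (d * p + n * q)%N = k, h`_q`_p != 0
    & weight_lt K d n k.+1 h].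
Proof.
move=> hd [hk hk1] hnz.
have [z zP] := prim_root_exists K d d0 dK.
have z0 : z != 0.
  apply: contra_eqN (prim_expr_order zP) => /eqP->.
  by rewrite expr0n gtn_eqF // eq_sym oner_eq0.
have h0 : h != 0.
  apply/eqP => h0; apply: hk1; rewrite h0.
  have [Y [Ya YN]] := hensel _ _ _ _ _ dK b0 ab k.+1.
  by apply/(ord_geP _ _ _ _ _ dK b0 _ _ _ _ Ya YN) => //; rewrite horner0 dvdp0.
have [c [p [q [c0 hT [hqp qd]]]]] := top_monomial_exists _ _ _ d0 _ h0 hd cop.
exists p, q; rewrite qd hqp c0.
suff E : (d * p + n * q)%N = k.
  split=> //; rewrite -E -(subrK ((c *: 'X^p)%:P * 'X^q) h); apply: weight_ltD.
    exact: weight_ltS.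
  exact: weight_monomial.
set G := norm_poly K d z h.
(* All conjugates of h share the exponents p, q of the top monomial. *)
have GT : exists2 e, e != 0 & top_monomial K d n G e (d * p) (d * q).
  have := @top_monomial_prod K d n 'I_d (index_enum 'I_d)
    (fun i => twist K (z ^+ i) h) (fun i => c * (z ^+ i) ^+ q) p q.
  have -> : size (index_enum 'I_d) = d by rewrite -[RHS]card_ord cardT enumT.
  apply=> i; last exact: top_monomial_twist.
  by rewrite mulf_neq0 // !expf_neq0.
case: GT => e e0 GT.
have Gi i : ~~ (d %| i)%N -> G`_i = 0 by exact: norm_poly_coef zP.
have sN := size_descend _ _ _ _ fsize d0 _ _ _ _ e0 Gi GT.
rewrite mulKn // in sN.
set W := (_ + _)%N in sN *.
set N := descend _ _ _ _ in sN.
have GY (Y : {poly K}) : G.[Y] = \prod_(i < d) h.[(z ^+ i)%:P * Y].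
  by rewrite horner_prod; apply: eq_bigr => i _; rewrite horner_twist.
have N0 : N != 0 by rewrite -size_poly_eq0 sN.
(* Over a root x of the norm some conjugate vanishes at (x, y), so h vanishes at (x, z^i y), which
   must then be P. *)
have [u u0 EN] : exists2 u, u != 0 & N = u *: ('X - a%:P) ^+ (size N).-1.
  apply: only_root => // x Nx.
  have [y yx] := exists_root_exp K d f.[x] d0.
  have := descend_dvd _ f _ d0 _ y%:P Gi; rewrite -/N => /dvdpP[t Et].
  have : (G.[y%:P]).[x] = 0.
    rewrite -(subrK N G.[y%:P]) Et !hornerE yx subrr mulr0.
    by rewrite (eqP Nx) addr0.
  rewrite GY horner_prod => /eqP; rewrite prodf_seq_eq0 => /hasP[i _ /= /eqP Ei].
  have : (x, z ^+ i * y) == (a, b).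
    apply/negP => /negP /hnz H; move: (H) => /(_ _)/negP; apply.
      by rewrite /on_curve exprMn exprAC (prim_expr_order zP) expr1n mul1r.
    by move: Ei; rewrite -polyCM /ev2 => ->.
  by case/eqP.
rewrite sN /= in EN.
(* The precision reaches order k + 1, which h must fail to have. *)
have [Y [Ya YN]] := hensel _ _ _ _ _ dK b0 ab (maxn k W).+1.
have hkY m : (m <= (maxn k W).+1)%N ->
    ord_ge f d a b h m <-> ('X - a%:P) ^+ m %| h.[Y].
  exact: ord_geP.
(* Up to the precision, N is the product of the h(x, z^i Y); factors with i nonzero do not vanish at
   a, because (a, z^i b) differs from P. *)
have dvdE m : (m <= (maxn k W).+1)%N ->
    (('X - a%:P) ^+ m %| h.[Y]) = (m <= W)%N.
  move=> mN.
  have -> : (m <= W)%N = (('X - a%:P) ^+ m %| N).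
    rewrite EN dvdpZr // dvdp_Pexp2l ?size_XsubC //.
  have -> : N = G.[Y] - (G.[Y] - N) by rewrite opprB addrC subrK.
  have dv : ('X - a%:P) ^+ m %| G.[Y] - N.
    apply: (@dvdp_trans _ (Y ^+ d - f)); last exact: descend_dvd.
    by apply: dvdp_trans YN; apply: dvdp_exp2l.
  rewrite dvdp_subl // GY (bigD1 (Ordinal d0)) //= expr0 mul1r Gauss_dvdpl //.
  apply: coprimep_expl; rewrite coprimep_sym coprimep_XsubC rootE horner_prod.
  rewrite prodf_seq_neq0; apply/allP => i _; apply/implyP => i0.
  rewrite ev2E !hornerE Ya hnz //.
    by rewrite /on_curve exprMn exprAC (prim_expr_order zP) expr1n mul1r.
  rewrite xpair_eqE eqxx /= -subr_eq0 -{2}[b]mul1r -mulrBl mulf_neq0 //.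
  rewrite subr_eq0 -(prim_order_dvd zP) gtnNdvd //.
  by rewrite lt0n; apply: contra i0 => /eqP i0; apply/eqP/val_inj.
apply/eqP; rewrite eq_sym eqn_leq; apply/andP; split.
  by rewrite -dvdE; [apply/hkY => //|]; rewrite ltnW // ltnS leq_maxl.
rewrite leqNgt -dvdE; last by rewrite ltnS leq_maxl.
by apply/negP => H; apply: hk1; apply/hkY => //; rewrite ltnS leq_maxl.
Qed.
End Principal.

(** * The equation satisfied by f *)

Lemma poly_size2 (R : nzRingType) (h : {poly R}) :
  (forall i, (1 < i)%N -> h`_i = 0) -> h = (h`_1)%:P * 'X + (h`_0)%:P.
Proof.
move=> h2; apply/polyP => -[|[|i]]; rewrite !coefD coefMX !coefC /= ?add0r //.
- by rewrite addr0.
- by rewrite h2 // addr0.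
Qed.

(** The function is x - a: its only zero is P, where y is a uniformizer because a is a simple root
    of f. *)
Lemma principal_ramified (K : fieldType) (f : {poly K}) d a : (1 < d)%N ->
  ~~ (('X - a%:P) ^+ 2 %| f) -> f.[a] = 0 -> principal_kP f d a 0 d.
Proof.
move=> d1 fsep fa; have d0 := ltnW d1.
have /factor_theorem[g Ef] : root f a by rewrite rootE fa.
have ga : g.[a] != 0.
  apply: contra fsep; rewrite -rootE -dvdp_XsubCl => ga.
  by rewrite Ef expr2 dvdp_mul.
exists (xm a); split; last first.
  move=> a' b' ab' ne; apply/(ord_eq0P _ _ _ _ _ _ ab').
  rewrite /ev2 /xm !hornerE subr_eq0; apply: contra ne => /eqP Ea.
  move: ab'; rewrite /on_curve Ea fa => /eqP; rewrite expf_eq0 d0 /= => /eqP->.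
  by [].
split.
  (* With f = (x - a) g, the curve gives g (x - a) = y^d, a generator of m_P^d. *)
  exists g%:P; split; first by rewrite /ev2 hornerC.
  exists (fun i => if i == 0%N then 1 else 0), (-1).
  rewrite big_ord_recl big1 /=; last by move=> i _; rewrite !mul0r.
  rewrite /xm /ym -polyCM -Ef /curve_poly !polyC0 subr0 subn0 expr0 !mul1r addr0.
  ring.
(* In terms of the uniformizer, x = a + y^d / g(a) satisfies the equation modulo y^(d+1), which is
   enough to refute order d + 1. *)
pose q := a%:P + g.[a]^-1 *: 'X^d.
pose e : {rmorphism {poly {poly K}} -> {poly K}} :=
  horner_eval 'X \o map_poly (comp_poly q).
have eE s : e s = (map_poly (comp_poly q) s).['X] by [].
have qa : q.[0] = a by rewrite /q !hornerE expr0n gtn_eqF // mulr0 addr0.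
have e0 s : (e s).[0] = ev2 s a 0.
  rewrite eE ev2E /ev2 hornerX.
  have := horner_map (comp_poly q) s 0%:P; rewrite /= comp_polyC => ->.
  by rewrite horner_comp qa.
have ex : e (xm a) = g.[a]^-1 *: 'X^d.
  by rewrite eE /xm map_polyC /= hornerC comp_polyB comp_polyX comp_polyC /q addrC addKr.
have ef p : e p%:P = p \Po q by rewrite eE map_polyC /= hornerC.
have eC : ('X - 0%:P) ^+ d.+1 %| e (curve_poly f d).
  rewrite /curve_poly (rmorphB e) ef {1}eE map_polyXn hornerXn Ef comp_polyM.
  have -> : ('X - a%:P) \Po q = g.[a]^-1 *: 'X^d by rewrite -ef -ex.
  have -> : 'X^d - (g \Po q) * (g.[a]^-1 *: 'X^d)
      = 'X^d * (1 - g.[a]^-1 *: (g \Po q)).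
    by rewrite -!mul_polyC; ring.
  rewrite polyC0 subr0 exprSr dvdp_mul //.
  rewrite -['X]subr0 -polyC0 dvdp_XsubCl rootE !hornerE horner_comp qa.
  by rewrite mulVf // subrr.
move=> /(ord_ge_dvd _ _ _ _ _ e _ _ _ _ e0 eC (leqnn _)).
rewrite ex polyC0 subr0 dvdpZr ?invr_eq0 // dvdp_Pexp2l ?size_polyX //.
by rewrite ltnn.
Qed.

Lemma natr_inj (K : fieldType) : (forall i, (i%:R == 0 :> K) = (i == 0%N)) ->
  injective (fun i : nat => i%:R : K).
Proof.
move=> ch i j; wlog ij : i j / (i <= j)%N => [H E|/eqP].
  by case/orP: (leq_total i j) => h; [|symmetry]; apply: H.
by rewrite eq_sym -subr_eq0 -natrB // ch subn_eq0 => ji; apply/eqP; rewrite eqn_leq ij.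
Qed.

(** The operator g -> (x - a) g' - m g kills (x - a)^m, so the equation makes (x - a1)^(d-1) divide
    v^(d-1) T with T = m v - d (x - a) v'; the factor v^(d-1) is coprime to x - a1. *)
Lemma wronskian_degree (K : fieldType) (f v : {poly K}) d m (a a1 : K) :
  [pchar K] =i pred0 -> ~~ (d %| m)%N -> v.[a1] != 0 ->
  f * ('X - a1%:P) ^+ d = ('X - a%:P) ^+ m - v ^+ d ->
  (d <= size v)%N.
Proof.
move=> /pcharf0P ch dm va E.
(* From here on [d], and then [m], stand for one less than the exponents. *)
case: d dm E => // d dm E.
case: m dm E => [|m] dm E; first by rewrite dvdn0 in dm.
set r := 'X - a1%:P in E; set p := 'X - a%:P in E.
have v0 : v != 0 by apply: contraNneq va => ->; rewrite horner0.
pose T := m.+1%:R *: v - d.+1%:R *: (p * v^`()).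
have TE : p * (f * r ^+ d.+1)^`() - m.+1%:R *: (f * r ^+ d.+1) = v ^+ d * T.
  rewrite {1 2}E derivB !deriv_exp /= derivXsubC.
  rewrite !exprS /T -!mul_polyC !rmorph_nat.
  rewrite -[_ *+ m.+1]mulr_natl -[_ *+ d.+1]mulr_natl.
  ring.
have rT : r ^+ d %| T.
  have : r ^+ d %| v ^+ d * T.
    rewrite -TE derivM deriv_exp /= derivXsubC mul1r dvdp_sub //.
      rewrite dvdp_mull // dvdp_add // dvdp_mull //.
        by rewrite dvdp_exp2l.
      by rewrite -mulr_natl dvdp_mull.
    by rewrite -mul_polyC !dvdp_mull // dvdp_exp2l.
  rewrite Gauss_dvdpr //; apply: coprimep_expl; apply: coprimep_expr.
  by rewrite coprimep_sym coprimep_XsubC rootE.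
have Tc i : T`_i = m.+1%:R * v`_i - d.+1%:R * (v`_i *+ i - a * (v`_i.+1 *+ i.+1)).
  rewrite coefB !coefZ /p mulrBl coefB coefCM coefXM !coef_deriv.
  by case: i => [|i] //=; rewrite coef_deriv.
(* The coefficient of T in degree deg v is that of v times m - d deg v, nonzero in characteristic 0
   since d does not divide m. *)
have T0 : T != 0.
  apply/eqP => T0; have := Tc (size v).-1.
  rewrite T0 coef0 (@nth_default _ _ v (size v).-1.+1); last first.
    by rewrite prednK // lt0n size_poly_eq0.
  move/esym/eqP; rewrite mul0rn mulr0 subr0 -[v`_ _ *+ _]mulr_natl mulrA -mulrBl mulf_eq0.
  rewrite -[v`_ _]/(lead_coef v) lead_coef_eq0 (negPf v0) orbF -natrM subr_eq0.
  move/eqP/(natr_inj K ch) => mE.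
  by move: dm; rewrite mE dvdn_mulr.
apply: leq_trans (_ : size T <= _)%N.
  by have := dvdp_leq T0 rT; rewrite size_exp_XsubC.
apply/leq_sizeP => j vj; rewrite Tc !nth_default ?(leqW vj) //.
by rewrite !(mul0rn, mulr0, subr0).
Qed.

(** * The two implications *)

Section Main.
Variables (K : closedFieldType) (d n : nat) (f : {poly K}) (a : K).
Hypotheses (charK : [pchar K] =i pred0) (d1 : (1 < d)%N) (dn : (d < n)%N).
Hypotheses (cop : coprime n d) (fmon : f \is monic) (fsize : size f = n.+1).
Hypothesis fsep : forall c : K, ~~ (('X - c%:P) ^+ 2 %| f).

Let d0 : (0 < d)%N := ltnW d1.
Let natrK : forall i, (i%:R == 0 :> K) = (i == 0%N).
Proof. exact/pcharf0P. Qed.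
Let dK : d%:R != 0 :> K. Proof. by rewrite natrK -lt0n. Qed.

Lemma dvdn_weightN : ~~ (d %| n + d)%N.
Proof.
rewrite dvdn_addl //; apply/negP => dn'; move: cop.
by rewrite /coprime (gcdn_idPr dn') gtn_eqF.
Qed.

(** A second point over a excludes functions whose value over a does not depend on y. *)
Lemma conjugate_point b : b != 0 -> on_curve f d a b ->
  exists2 b', on_curve f d a b' & b' != b.
Proof.
move=> b0 ab; have [z zP] := prim_root_exists K d d0 dK.
exists (z * b); first by rewrite /on_curve exprMn (prim_expr_order zP) mul1r.
rewrite -subr_eq0 -{2}[b]mul1r -mulrBl mulf_neq0 // subr_eq0.
by rewrite -[z]expr1 -(prim_order_dvd zP) gtnNdvd.
Qed.

Lemma order_equation b : on_curve f d a b -> point_order f d a b (n + d) ->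
  exists (a1 : K) (v : {poly K}), [/\ a1 != a, (d - 1 <= (size v).-1)%N,
    ((size v).-1 * d < n + d)%N, v.[a1] != 0
    & f * ('X - a1%:P) ^+ d = ('X - a%:P) ^+ (n + d) - v ^+ d].
Proof.
move=> ab [_ [Pm Pmin]].
have b0 : b != 0.
  apply/eqP => b0; apply: (Pmin d d0); first by rewrite -{1}[d]add0n ltn_add2r; lia.
  rewrite b0; apply: principal_ramified => //.
  by rewrite -ab b0 expr0n gtn_eqF.
have [h [hd [hP hnz]]] := principal_kP_reduced _ _ _ _ _ _ Pm d0.
have [p [q [qd pq hqp hW]]] :=
  zero_order_eq_weight _ _ _ _ _ _ fsize d0 cop dK b0 ab _ _ hd hP hnz.
(* In d p + n q = n + d, q = 0 would give d | n + d, and q >= 2 is too large since d < n. *)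
have q1 : q = 1%N.
  case: q qd pq {hqp} => [|[|q]] // _ pq.
    by have := dvdn_weightN; rewrite -pq muln0 addn0 dvdn_mulr.
  by exfalso; move: pq; rewrite !mulnS; lia.
have p1 : p = 1%N.
  have : (d * p = d * 1)%N by move: pq; rewrite q1 !muln1; lia.
  by move/eqP; rewrite eqn_pmul2l // => /eqP.
move: hqp; rewrite q1 p1 => c0.
set c := h`_1`_1 in c0.
pose A := h`_1; pose B := h`_0.
have hE : h = A%:P * 'X + B%:P.
  apply: poly_size2 => i i2; apply/polyP => j; rewrite coef0; apply: hW.
  have : (n * 2 <= n * i)%N by rewrite leq_mul2l i2 orbT.
  by move: (d * j)%N (n * i)%N; lia.
have AE : A = c%:P * 'X + (A`_0)%:P.
  apply: poly_size2 => j j2; apply: hW.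
  have : (d * 2 <= d * j)%N by rewrite leq_mul2l j2 orbT.
  by move: (d * j)%N; lia.
(* Weights give d deg B <= n + d, and d does not divide n + d. *)
have Bs : ((size B).-1 * d < n + d)%N.
  rewrite ltnNge; apply/negP => Bd.
  have [Bs0|Bs0] := posnP (size B); first by move: Bd; rewrite Bs0 mul0n; lia.
  have : B`_(size B).-1 = 0.
    apply: hW; rewrite muln0 addn0 mulnC ltn_neqAle Bd andbT.
    by apply: contra dvdn_weightN => /eqP->; rewrite dvdn_mull.
  by apply/eqP; rewrite -[B`_ _]/(lead_coef B) lead_coef_eq0 -size_poly_eq0 -lt0n.
pose a1 := - A`_0 / c.
have AF : A = c%:P * ('X - a1%:P).
  by rewrite {1}AE mulrBr -polyCM /a1 (mulrC c) divfK // polyCN opprK.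
pose u := - c^-1 *: B.
have su : size u = size B by rewrite size_scale // oppr_eq0 invr_eq0.
have BE : B = - (c%:P * u).
  by rewrite /u mul_polyC scalerA mulrN divff // scaleN1r opprK.
have [Y [Ya YN]] := hensel _ _ _ _ _ dK b0 ab (n + d).
have [hP1 _] := hP.
have hY : ('X - a%:P) ^+ (n + d) %| h.[Y].
  by apply/(ord_geP _ _ _ _ _ dK b0 _ _ _ _ Ya YN).
have hYE : h.[Y] = c%:P * (('X - a1%:P) * Y - u).
  by rewrite hE !hornerE AF BE; ring.
rewrite hYE mul_polyC dvdpZr // in hY.
set r := 'X - a1%:P in AF hYE hY *.
(* Y^d agrees with f to order n + d, and r Y - u divides (r Y)^d - u^d. *)
have dv : ('X - a%:P) ^+ (n + d) %| f * r ^+ d - u ^+ d.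
  have -> : f * r ^+ d - u ^+ d = ((r * Y) ^+ d - u ^+ d) - r ^+ d * (Y ^+ d - f).
    by rewrite exprMn; ring.
  by apply: dvdp_sub; [rewrite subrXX dvdp_mulr|rewrite dvdp_mull].
have rmon : r \is monic by apply: monicXsubC.
have fr : f * r ^+ d \is monic by rewrite monicMl // monic_exp.
have sfr : size (f * r ^+ d) = (n + d).+1.
  rewrite size_Mmonic ?monic_neq0 ?monic_exp // fsize /r size_exp_XsubC.
  by rewrite addnS.
have sud : (size (u ^+ d) < (n + d).+1)%N.
  rewrite ltnS; have [->|u0] := eqVneq (u ^+ d) 0; first by rewrite size_poly0.
  by rewrite -[size _]prednK ?lt0n ?size_poly_eq0 // size_exp su.
(* Both sides are monic of degree n + d, since d deg u < n + d, so divisibility is equality. *)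
have Ef : f * r ^+ d - u ^+ d = ('X - a%:P) ^+ (n + d).
  have s : size (f * r ^+ d - u ^+ d) = (n + d).+1.
    by rewrite size_polyDl sfr // size_polyN.
  have := dvdp_size_eqp dv; rewrite s size_exp_XsubC eqxx => /esym.
  rewrite eqp_monic ?monic_exp ?monicXsubC //; first by move/eqP.
  by rewrite monicE lead_coefDl ?sfr ?size_polyN // -monicE.
have [w wd] := exists_root_exp K d (-1) d0.
have w0 : w != 0.
  apply: contra_eqN wd => /eqP->; rewrite expr0n gtn_eqF //.
  by rewrite eq_sym oppr_eq0 oner_eq0.
have E : f * r ^+ d = ('X - a%:P) ^+ (n + d) - (w *: u) ^+ d.
  by rewrite exprZn wd scaleN1r opprK -Ef subrK.
(* If a1 = a, then h(a, y) = B(a) for all y, and h also vanishes at a conjugate of P. *)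
have a1a : a1 != a.
  apply/eqP => a1a.
  have ev y : ev2 h a y = B.[a].
    by rewrite /ev2 hE !hornerE AF /r a1a !hornerE subrr mulr0 mul0r add0r.
  have [b' ab' bb'] := conjugate_point b b0 ab.
  have ne : (a, b') != (a, b) by rewrite xpair_eqE eqxx.
  have /eqP[] := hnz _ _ ab' ne.
  rewrite ev -(ev b) -Ya -ev2E; apply/eqP; rewrite -rootE -dvdp_XsubCl.
  apply: (@dvdp_trans _ (('X - a%:P) ^+ (n + d))).
    by rewrite dvdp_exp // addn_gt0 d0 orbT.
  by rewrite hYE dvdp_mull.
have va1 : (w *: u).[a1] != 0.
  apply/eqP => v0; have := congr1 (horner^~ a1) E.
  rewrite /= hornerD hornerN [(_ ^+ d).[a1]]horner_exp v0 /r !hornerE subrr.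
  rewrite !expr0n gtn_eqF // mulr0 subr0 => /esym/eqP.
  by rewrite expf_eq0 subr_eq0 (negPf a1a) andbF.
exists a1, (w *: u); split=> //.
  rewrite -subn1 leq_sub2r //.
  exact: wronskian_degree charK dvdn_weightN va1 E.
by rewrite size_scale // su.
Qed.

Lemma point_order_of_equation (a1 : K) (v : {poly K}) : a1 != a ->
  ((size v).-1 * d < n + d)%N -> v.[a1] != 0 ->
  f * ('X - a1%:P) ^+ d = ('X - a%:P) ^+ (n + d) - v ^+ d ->
  exists b, on_curve f d a b /\ point_order f d a b (n + d).
Proof.
move=> a1a vd va1; set r := 'X - a1%:P; set p := 'X - a%:P => E.
have [z zd] := exists_root_exp K d (-1) d0.
have z0 : z != 0.
  apply: contra_eqN zd => /eqP->; rewrite expr0n gtn_eqF //.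
  by rewrite eq_sym oppr_eq0 oner_eq0.
pose w := z *: v.
have wE : r ^+ d * f - w ^+ d = p ^+ (n + d).
  by rewrite mulrC E /w exprZn zd scaleN1r opprK subrK.
have sw : size w = size v by rewrite size_scale.
have wa1 : w.[a1] != 0 by rewrite hornerZ mulf_neq0.
have nd0 : (n + d)%N != 0%N by rewrite -lt0n addn_gt0 d0 orbT.
have ra : r.[a] != 0 by rewrite !hornerE subr_eq0 eq_sym.
(* Otherwise (x - a)^2 divides r^d f, hence f. *)
have wa : w.[a] != 0.
  apply: contra (fsep a) => wa.
  have : p ^+ 2 %| r ^+ d * f.
    rewrite -(subrK (w ^+ d) (r ^+ d * f)) wE; apply: dvdp_add.
      by apply: dvdp_exp2l; rewrite (leq_trans d1) // leq_addl.
    have pw : p %| w by rewrite dvdp_XsubCl; exact: wa.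
    exact: dvdp_trans (dvdp_exp2l p d1) (dvdp_exp2r d pw).
  rewrite Gauss_dvdpr //; apply: coprimep_expl; apply: coprimep_expr.
  by rewrite coprimep_sym coprimep_XsubC rootE.
(* The only ordinate over a where r y - w vanishes. *)
pose b := w.[a] / r.[a].
have b0 : b != 0 by rewrite mulf_neq0 // invr_eq0.
have bE x y : y ^+ d = f.[x] ->
    (r.[x] * y) ^+ d - w.[x] ^+ d = (x - a) ^+ (n + d).
  move=> xy; have := congr1 (horner^~ x) wE.
  rewrite /= hornerD hornerN hornerM !horner_exp exprMn xy => ->.
  by rewrite hornerXsubC.
have ab : on_curve f d a b.
  have := congr1 (horner^~ a) wE.
  rewrite /= hornerD hornerN hornerM !horner_exp [p.[a]]hornerXsubC subrr.
  rewrite expr0n (negPf nd0) => /eqP; rewrite subr_eq0 /on_curve expr_div_n.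
  by move=> /eqP <-; rewrite mulrC mulKf // expf_neq0.
exists b; split=> //; split; first by rewrite lt0n.
have rb : r.[a] * b = w.[a] by rewrite mulrC divfK.
(* The cofactor of r Y - w in (r Y)^d - w^d has value d w(a)^(d-1) at a, and that difference is (x -
   a)^(n+d) up to the precision N. *)
have dvdE (Y : {poly K}) N j : Y.[a] = b -> p ^+ N %| Y ^+ d - f -> (j <= N)%N ->
    (p ^+ j %| r * Y - w) = (j <= n + d)%N.
  move=> Ya YN jN.
  have -> : (p ^+ j %| r * Y - w) = (p ^+ j %| (r * Y) ^+ d - w ^+ d).
    rewrite subrXX Gauss_dvdpl //; apply: coprimep_expl.
    rewrite coprimep_sym coprimep_XsubC rootE (geom_at _ _ _ _ _ w.[a]) //.
      by rewrite mulf_neq0 // expf_neq0.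
    by rewrite hornerM Ya rb.
  have -> : (r * Y) ^+ d - w ^+ d = p ^+ (n + d) + r ^+ d * (Y ^+ d - f).
    by rewrite -wE exprMn; ring.
  rewrite dvdp_addl ?dvdp_Pexp2l ?size_XsubC // dvdp_mull //.
  by apply: dvdp_trans YN; apply: dvdp_exp2l.
pose h : {poly {poly K}} := r%:P * 'X - w%:P.
have hY Y : h.[Y] = r * Y - w by rewrite !hornerE.
split.
  exists h; split.
    have [Y [Ya YN]] := hensel _ _ _ _ _ dK b0 ab (n + d).+1.
    split.
      apply/(ord_geP _ _ _ _ _ dK b0 _ _ _ _ Ya YN) => //.
      by rewrite hY (dvdE Y _ _ Ya YN).
    move/(ord_geP _ _ _ _ _ dK b0 _ _ _ _ Ya YN) => /(_ (leqnn _)).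
    by rewrite hY (dvdE Y _ _ Ya YN) // ltnn.
  move=> a' b' ab' ne; apply/(ord_eq0P _ _ _ _ _ _ ab').
  rewrite /ev2 hY; apply: contra ne; rewrite hornerD hornerN hornerM hornerC.
  rewrite subr_eq0 => /eqP rw.
  have := bE a' b' ab'; rewrite rw subrr => /esym/eqP.
  rewrite expf_eq0 subr_eq0 => /andP[_ /eqP aa].
  rewrite xpair_eqE aa eqxx /=; apply/eqP/(mulfI ra).
  by rewrite rb -aa.
move=> k k0 km Pk.
have [g [gd [gP gnz]]] := principal_kP_reduced _ _ _ _ _ _ Pk d0.
have [i [q [qd pq gqp gW]]] :=
  zero_order_eq_weight _ _ _ _ _ _ fsize d0 cop dK b0 ab _ _ gd gP gnz.
pose c := g`_1`_0; pose u := g`_0.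
(* Weights at most k < n + d leave no room for x y or y^2. *)
have gE : g = (c%:P)%:P * 'X + u%:P.
  rewrite {1}[g]poly_size2 => [|l l2].
    congr (_%:P * _ + _); apply: size1_polyC; apply/leq_sizeP => j j1.
    apply: gW; have : (d * 1 <= d * j)%N by rewrite leq_mul2l j1 orbT.
    by rewrite muln1; clear -km; lia.
  apply/polyP => j; rewrite coef0; apply: gW.
  have : (n * 2 <= n * l)%N by rewrite leq_mul2l l2 orbT.
  by move: (d * j)%N (n * l)%N; clear -km dn; lia.
have [Y [Ya YN]] := hensel _ _ _ _ _ dK b0 ab k.
have gY : p ^+ k %| c%:P * Y + u.
  have <- : g.[Y] = c%:P * Y + u by rewrite gE !hornerE.
  by have [gP1 _] := gP; apply/(ord_geP _ _ _ _ _ dK b0 _ _ _ _ Ya YN).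
have ev y : ev2 g a y = c * y + u.[a] by rewrite /ev2 gE !hornerE.
(* If c = 0, then g = u(x) also vanishes at a conjugate of P. *)
have c0 : c != 0.
  apply/eqP => c0; have [b' ab' bb'] := conjugate_point b b0 ab.
  have ne : (a, b') != (a, b) by rewrite xpair_eqE eqxx.
  have /eqP[] := gnz _ _ ab' ne; rewrite ev c0 mul0r add0r.
  apply/eqP; rewrite -rootE -dvdp_XsubCl.
  have -> : u = c%:P * Y + u by rewrite c0 mul0r add0r.
  by apply: dvdp_trans gY; rewrite dvdp_exp.
have nk : (n <= k)%N.
  rewrite leqNgt; apply: contra c0 => nk; apply/eqP/gW.
  by rewrite muln0 muln1.
have wY : p ^+ k %| r * Y - w by rewrite (dvdE Y k k) // ltnW.
(* Y is eliminated between c Y + u and r Y - w, both divisible by (x - a)^k; moreover T(a1) = c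
   w(a1). *)
pose T := r * u + c%:P * w.
have TE : T = r * (c%:P * Y + u) - c%:P * (r * Y - w) by rewrite /T; ring.
have pT : p ^+ k %| T by rewrite TE dvdp_sub // dvdp_mull.
have T0 : T != 0.
  apply/eqP => T0; have /eqP := congr1 (horner^~ a1) T0.
  rewrite /= /T hornerD !hornerM hornerC [r.[a1]]hornerXsubC subrr mul0r add0r.
  by rewrite horner0 mulf_eq0 (negPf c0) (negPf wa1).
have := dvdp_leq T0 pT; rewrite size_exp_XsubC => kT.
have us : (d * (size u).-1 <= k)%N.
  have [->|us] := posnP (size u); first by rewrite muln0.
  rewrite leqNgt; apply/negP => ud.
  have : u`_(size u).-1 = 0 by apply: gW; rewrite muln0 addn0.
  by apply/eqP; rewrite -[u`_ _]/(lead_coef u) lead_coef_eq0 -size_poly_eq0 -lt0n.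
have sT : (size T <= maxn (size u).+1 (size v))%N.
  apply: leq_trans (size_polyD _ _) _; rewrite geq_max; apply/andP; split.
    rewrite leq_max; apply/orP; left; rewrite (leq_trans (size_polyMleq _ _)) //.
    by rewrite size_XsubC.
  by rewrite mul_polyC size_scale // sw leq_maxr.
(* Recall n <= k. Either deg u >= k - 1, and d deg u <= k forces k <= 2 < n; or deg v >= k, and then
   2 k < n + d < 2 n. *)
have := leq_trans kT sT; rewrite leq_max ltnS => /orP[ku|kv].
  have : (2 * (size u).-1 <= d * (size u).-1)%N by rewrite leq_mul2r d1 orbT.
  move: us ku; move: (d * _)%N => e; move: (size _) => s; clear -nk dn d1; lia.
have : (k * d <= (size v).-1 * d)%N.
  rewrite leq_mul2r; move: kv; case: (size v) => // s; rewrite ltnS => ->.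
  by rewrite orbT.
have : (k * 2 <= k * d)%N by rewrite leq_mul2l d1 orbT.
move: vd; move: (k * d)%N ((size v).-1 * d)%N => x y; clear -nk dn; lia.
Qed.
End Main.

Theorem theorem6p1 (K : closedFieldType) (charK : [pchar K] =i pred0)
  (d n : nat) (hd1 : (1 < d)%N) (hdn : (d < n)%N) (hcop : coprime n d)
  (f : {poly K}) (fmon : f \is monic) (fsize : size f = n.+1)
  (fsep : forall c : K, ~~ (('X - c%:P) ^+ 2 %| f))
  (a : K) :
  let m1 := (n + d)%N in
  ((exists b : K, on_curve f d a b /\ point_order f d a b m1) <->
   (exists (a1 : K) (v : {poly K}),
      [/\ a1 != a,
          (d - 1 <= (size v).-1)%N,
          ((size v).-1 * d < m1)%N,
          v.[a1] != 0
        & f * ('X - a1%:P) ^+ d = ('X - a%:P) ^+ m1 - v ^+ d]))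
  /\
  ((exists b : K, on_curve f d a b /\ point_order f d a b m1) ->
   (d * d - d < m1)%N).
Proof.
move=> m1; split; first split.
- case=> b [ab Pm].
  exact: (order_equation K d n f a charK hd1 hdn hcop fmon fsize fsep b).
- case=> a1 [v [a1a _ vd va1 E]].
  exact: (point_order_of_equation K d n f a charK hd1 hdn hcop fsize fsep a1 v).
case=> b [ab Pm].
have [a1 [v [_ dv vd _ _]]] :=
  order_equation K d n f a charK hd1 hdn hcop fmon fsize fsep b ab Pm.
(* The bound is d (d - 1) <= d deg v < n + d. *)
apply: leq_ltn_trans vd.
have : ((d - 1) * d <= (size v).-1 * d)%N by rewrite leq_mul2r dv orbT.
by rewrite mulnBl mul1n.
Qed.
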